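(* Let $\mathbf{L}\in\mathbb{R}^{N\times N}$ be any Laplacian matrix of an undirected weighted graph on $N$ nodes, with eigenvalue decomposition $\mathbf{L}=\mathbf{U}\mathbf{\Lambda}\mathbf{U}^{\mathsf T}$, where $\mathbf{U}$ is orthogonal and $\mathbf{\Lambda}$ is diagonal. Then there is a partial permutation matrix $\mathbf{P}_N\in\{0,1\}^{N^2\times N}$ such that $$\mathbf{L}^{(2)}=\mathbf{P}_N^{\mathsf T}(\mathbf{U}\otimes\mathbf{U})(\mathbf{\Lambda}\otimes\mathbf{\Lambda})(\mathbf{U}^{\mathsf T}\otimes\mathbf{U}^{\mathsf T})\mathbf{P}_N ,$$ and, for every integer $\rho\ge 2$, there is a partial permutation matrix $\mathbf{P}_{(\rho)}\in\{0,1\}^{N^2\times N}$ such that $$\mathbf{L}^{(\rho)}=\mathbf{P}_{(\rho)}^{\mathsf T}(\mathbf{U}\otimes\mathbf{U}_{(\rho-1)})(\mathbf{\Lambda}\otimes\mathbf{\Lambda}_{(\rho-1)})(\mathbf{U}^{\mathsf T}\otimes\mathbf{U}_{(\rho-1)}^{\mathsf T})\mathbf{P}_{(\rho)},$$ where $\mathbf{U}_{(\rho-1)}$ and $\mathbf{\Lambda}_{(\rho-1)}$ are respectively the (orthogonal) matrix of eigenvectors and the (diagonal) matrix of eigenvalues of $\mathbf{L}^{(\rho-1)}$, i.e. $\mathbf{L}^{(\rho-1)}=\mathbf{U}_{(\rho-1)}\mathbf{\Lambda}_{(\rho-1)}\mathbf{U}_{(\rho-1)}^{\mathsf T}$.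
   Context: For an undirected graph with symmetric nonnegative weighted adjacency matrix $\mathbf{A}$ (zero diagonal) and degree matrix $\mathbf{D}=\operatorname{diag}(\mathbf{A}\mathbf{1})$, ''any Laplacian matrix'' means the combinatorial Laplacian $\mathbf{D}-\mathbf{A}$ or the symmetric normalized Laplacian $\mathbf{I}-\mathbf{D}^{-1/2}\mathbf{A}\mathbf{D}^{-1/2}$; both are real symmetric. For an integer $\rho\ge1$, $\mathbf{L}^{(\rho)}=\mathbf{L}\circ\cdots\circ\mathbf{L}$ ($\rho$ factors) is the Hadamard (entrywise) power, and $\otimes$ is the Kronecker product. A partial permutation matrix is a $0$-$1$ matrix having at most one entry equal to $1$ in each row and in each column; here the matrices $\mathbf{P}_N$ and $\mathbf{P}_{(\rho)}$ are the selection matrices realizing the Hadamard product as a submatrix of the Kronecker product, $\mathbf{S}\circ\mathbf{T}=\mathbf{P}^{\mathsf T}(\mathbf{S}\otimes\mathbf{T})\mathbf{P}$ for $\mathbf{S},\mathbf{T}\in\mathbb{R}^{N\times N}$. *)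

(* Defs.v *)
(* The real numbers are an arbitrary real closed field: the
   only non-algebraic operation involved is the square root in D^(-1/2). *)
From mathcomp Require Import all_boot all_order all_algebra.
From mathcomp Require Import mxtens.

Set Implicit Arguments.
Unset Strict Implicit.
Unset Printing Implicit Defensive.

Import Order.TTheory GRing.Theory Num.Theory.
Local Open Scope ring_scope.

Definition is_adjacency (R : rcfType) (N : nat) (A : 'M[R]_N) : Prop :=
  [/\ A^T = A, forall i j, 0 <= A i j & forall i, A i i = 0].

Definition degrees (R : rcfType) (N : nat) (A : 'M[R]_N) : 'cV[R]_N :=
  A *m const_mx 1.

Definition combinatorial_laplacian (R : rcfType) (N : nat) (A : 'M[R]_N) :
  'M[R]_N := diag_mx (degrees A)^T - A.

(* For an isolated node the entry of D^(-1/2) is 0, since 0^-1 = 0. *)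
Definition inv_sqrt_degree_mx (R : rcfType) (N : nat) (A : 'M[R]_N) :
  'M[R]_N := diag_mx (map_mx (fun d => (Num.sqrt d)^-1) (degrees A)^T).

Definition normalized_laplacian (R : rcfType) (N : nat) (A : 'M[R]_N) :
  'M[R]_N := 1%:M - inv_sqrt_degree_mx A *m A *m inv_sqrt_degree_mx A.

Definition is_laplacian (R : rcfType) (N : nat) (L : 'M[R]_N) : Prop :=
  exists A : 'M[R]_N, is_adjacency A /\
    (L = combinatorial_laplacian A \/ L = normalized_laplacian A).

Definition orthogonal_mx (R : rcfType) (N : nat) (U : 'M[R]_N) : Prop :=
  U^T *m U = 1%:M /\ U *m U^T = 1%:M.

(* The diagonal of Lam lists the eigenvalues of M, and the columns of U are
   corresponding orthonormal eigenvectors. *)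
Definition is_evd (R : rcfType) (N : nat) (M U Lam : 'M[R]_N) : Prop :=
  [/\ orthogonal_mx U, is_diag_mx Lam & M = U *m Lam *m U^T].

Definition hadamard (R : rcfType) (m n : nat) (S T : 'M[R]_(m, n)) :
  'M[R]_(m, n) := map2_mx *%R S T.

(* M o ... o M with rho factors; for rho = 0 this is the all-ones matrix. *)
Definition hadamard_pow (R : rcfType) (m n : nat) (M : 'M[R]_(m, n))
    (rho : nat) : 'M[R]_(m, n) :=
  iterop rho (@hadamard R m n) M (const_mx 1).

Definition is_partial_perm_mx (R : rcfType) (m n : nat) (P : 'M[R]_(m, n)) :
  Prop :=
  [/\ forall i j, P i j = 0 \/ P i j = 1,
      forall i, (#|[set j | P i j == 1%R]| <= 1)%N &
      forall j, (#|[set i | P i j == 1%R]| <= 1)%N].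

(* "*t" is the Kronecker product of mathcomp.real_closed.mxtens: the entry of
   S *t T at row (i, j) and column (k, l) is S i k * T j l, where the pair
   (i, j) is the index i * N + j. *)
Definition is_hadamard_selection (R : rcfType) (N : nat)
    (P : 'M[R]_(N * N, N)) : Prop :=
  forall S T : 'M[R]_N, hadamard S T = P^T *m (S *t T) *m P.

(* Main.v *)
(* Keeping only the rows and columns of index (k, k) turns a Kronecker product
   into a Hadamard product.  Apply this to L and its Hadamard power of order
   rho - 1, and diagonalize their Kronecker product by the mixed-product rule. *)
Require Import Defs.
From mathcomp Require Import all_boot all_order all_algebra.
From mathcomp Require Import mxtens.

Set Implicit Arguments.
Unset Strict Implicit.
Unset Printing Implicit Defensive.

Import Order.TTheory GRing.Theory Num.Theory.
Local Open Scope ring_scope.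

(** Column [k] is the Kronecker square of the [k]-th standard basis vector. *)
Definition diag_selection (R : rcfType) (N : nat) : 'M[R]_(N * N, N) :=
  \matrix_(p, k) (p == mxtens_index (k, k))%:R.

Lemma diag_selectionE (R : rcfType) (N : nat) (p : 'I_(N * N)) (k : 'I_N) :
  (diag_selection R N p k == 1) = (p == mxtens_index (k, k)).
Proof. by rewrite mxE; case: (p == _); rewrite ?eqxx // eq_sym oner_eq0. Qed.

Lemma diag_selection_partial_perm (R : rcfType) (N : nat) :
  is_partial_perm_mx (diag_selection R N).
Proof.
split=> [p k|p|k].
- by rewrite mxE; case: eqP => _; [right | left].
(* Injectivity of [mxtens_index]: the pairs [(k, k)] and [(l, l)] share a row only if [k = l]. *)
- apply/card_le1P => k; rewrite inE diag_selectionE => /eqP-> l.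
  rewrite !inE diag_selectionE (can_eq (@mxtens_indexK N N)) xpair_eqE andbb.
  exact: eq_sym.
- rewrite (eq_card (B := pred1 (mxtens_index (k, k)))) ?card1 // => p.
  by rewrite !inE diag_selectionE.
Qed.

Lemma diag_selection_hadamard (R : rcfType) (N : nat) :
  is_hadamard_selection (diag_selection R N).
Proof.
have sel (m : nat) (A : 'M[R]_(m, N * N)) i k :
    (A *m diag_selection R N) i k = A i (mxtens_index (k, k)).
  rewrite mxE (bigD1 (mxtens_index (k, k))) //= mxE eqxx mulr1 big1 ?addr0 //.
  by move=> p /negPf np; rewrite mxE np mulr0.
(* Transposing the remaining product puts the selection on the right, so [sel] also picks the
   rows. *)
move=> S T; apply/matrixP => i j; rewrite sel -[_ *m _]trmxK trmx_mul trmxK.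
by rewrite [RHS]mxE sel [RHS]mxE tensmxE mxE.
Qed.

Lemma evd_tens (R : rcfType) (M N : nat) (A U Lam : 'M[R]_M)
    (B V Mu : 'M[R]_N) :
  is_evd A U Lam -> is_evd B V Mu ->
  A *t B = (U *t V) *m (Lam *t Mu) *m (U^T *t V^T).
Proof. by move=> [_ _ ->] [_ _ ->]; rewrite !tensmx_mul. Qed.

(** Starting at [k.+2] makes this definitional: [iterop] returns [A] itself at order 1, with no
    all-ones factor. *)
Lemma hadamard_powS (R : rcfType) (m n : nat) (A : 'M[R]_(m, n)) (k : nat) :
  hadamard_pow A k.+2 = hadamard A (hadamard_pow A k.+1).
Proof. by []. Qed.

Theorem theorem2 (R : rcfType) (N : nat) (L U Lam : 'M[R]_N)
    (hL : is_laplacian L) (hevd : is_evd L U Lam) :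
  (exists P : 'M[R]_(N * N, N),
     [/\ is_partial_perm_mx P,
         is_hadamard_selection P &
         hadamard_pow L 2 =
           P^T *m (U *t U) *m (Lam *t Lam) *m (U^T *t U^T) *m P])
  /\
  (forall rho : nat, (2 <= rho)%N ->
     exists P : 'M[R]_(N * N, N),
       [/\ is_partial_perm_mx P,
           is_hadamard_selection P &
           forall U' Lam' : 'M[R]_N,
             is_evd (hadamard_pow L (rho - 1)) U' Lam' ->
             hadamard_pow L rho =
               P^T *m (U *t U') *m (Lam *t Lam') *m (U^T *t U'^T) *m P]).
Proof.
have selP := @diag_selection_hadamard R N.
have permP := @diag_selection_partial_perm R N.
split=> [|[|[|k]] // _]; exists (diag_selection R N); split=> //.
  (* [hadamard_pow L 1] is convertible to [L], so [hevd] serves for both factors. *)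
  by rewrite hadamard_powS selP (evd_tens hevd hevd) !mulmxA.
(* Here [rho] is [k.+2], and its predecessor reduces to the [k.+1] of [hadamard_powS]. *)
move=> U' Lam' hevd'; rewrite subn1 in hevd'.
by rewrite hadamard_powS selP (evd_tens hevd hevd') !mulmxA.
Qed.
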